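(* $\chi_\mu(K_n\,\square\, K_n)=\Theta(\sqrt{n})$ as $n\to\infty$; that is, there exist constants $c_1,c_2>0$ and $N$ such that $c_1\sqrt{n}\le \chi_\mu(K_n\,\square\, K_n)\le c_2\sqrt{n}$ for all $n\ge N$.
   Context: $K_n\,\square\, K_n$ is the Cartesian product of two complete graphs on $n$ vertices: vertex set $V(K_n)\times V(K_n)$, with $(g,h)$ adjacent to $(g',h')$ iff either $g=g'$ and $h\ne h'$, or $h=h'$ and $g\neq g'$. For a connected graph $G$ and $S\subseteq V(G)$, two vertices $x,y\in S$ are $S$-visible if there is a shortest $x,y$-path $P$ in $G$ with $V(P)\cap S=\{x,y\}$. $S$ is a mutual-visibility set if any two vertices of $S$ are $S$-visible. A mutual-visibility coloring of $G$ is a partition of $V(G)$ into mutual-visibility sets, and the mutual-visibility chromatic number $\chi_\mu(G)$ is the smallest number of classes in such a partition. *)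

(* Defs.v *)
From mathcomp Require Import all_boot all_order all_algebra.
From mathcomp Require Import boolp reals.

Set Implicit Arguments.
Unset Strict Implicit.
Unset Printing Implicit Defensive.

(* A finite simple graph is its adjacency relation, a symmetric and
   irreflexive [rel] on a finType. *)

Definition complete_graph (n : nat) : rel 'I_n := fun i j => i != j.

Definition cartesian_product (T1 T2 : finType) (e1 : rel T1) (e2 : rel T2) :
    rel (T1 * T2) :=
  fun u v => (u.1 == v.1) && e2 u.2 v.2 || (u.2 == v.2) && e1 u.1 v.1.

Definition rook_graph (n : nat) : rel ('I_n * 'I_n) :=
  cartesian_product (@complete_graph n) (@complete_graph n).

Section MutualVisibility.
Variables (T : finType) (e : rel T).
Implicit Types (x y : T) (p q : seq T) (S : {set T}) (P : {set {set T}}).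

(* As in [path.v], the path with vertex sequence [x :: p] is given by [x] and
   [p]; its length is [size p]. *)
Definition is_path x y p : bool :=
  [&& path e x p, last x p == y & uniq (x :: p)].

Definition shortest_path x y p : Prop :=
  is_path x y p /\ forall q, is_path x y q -> size p <= size q.

Definition visible S x y : Prop :=
  exists2 p, shortest_path x y p & [set z in x :: p] :&: S = [set x; y].

(* Allowing x = y adds no condition, by [visible_refl] below. *)
Definition mutual_visibility_set S : Prop :=
  forall x y, x \in S -> y \in S -> visible S x y.

Definition mv_coloring P : Prop :=
  partition P [set: T] /\ forall S, S \in P -> mutual_visibility_set S.

Definition mv_colorable (k : nat) : Prop :=
  exists2 P, mv_coloring P & #|P| = k.

Lemma visible_refl S x : x \in S -> visible S x x.
Proof.
move=> xS; exists [::]; first by split=> //; rewrite /is_path /= eqxx.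
apply/setP=> z; rewrite !inE orbb.
by case: eqP => [->|].
Qed.

Lemma mutual_visibility_set1 x : mutual_visibility_set [set x].
Proof. by move=> y z /set1P-> /set1P->; apply/visible_refl/set11. Qed.

Lemma mv_coloring_singletons : mv_coloring [set [set x] | x in T].
Proof.
split; last by move=> _ /imsetP[x _ ->]; apply: mutual_visibility_set1.
apply/and3P; split.
- apply/eqP/setP=> x; rewrite inE; apply/bigcupP.
  by exists [set x]; rewrite ?imset_f ?set11.
- apply/trivIsetP=> _ _ /imsetP[x _ ->] /imsetP[y _ ->] neq_xy.
  by rewrite disjoints1 inE; apply: contra neq_xy => /eqP->.
- by apply/imsetP=> -[x _] /setP/(_ x); rewrite !inE eqxx.
Qed.

Lemma mv_colorable_ex : exists k, `[< mv_colorable k >].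
Proof.
exists #|[set [set x] | x in T]|; apply/asboolP.
by exists [set [set x] | x in T]; first exact: mv_coloring_singletons.
Qed.

Definition mv_chromatic_number : nat := ex_minn mv_colorable_ex.

End MutualVisibility.

Lemma rook_graph_sym n : symmetric (@rook_graph n).
Proof.
move=> u v; rewrite /rook_graph /cartesian_product /complete_graph.
by rewrite ![v.1 == _]eq_sym ![v.2 == _]eq_sym.
Qed.

Lemma rook_graph_irr n : irreflexive (@rook_graph n).
Proof. by move=> u; rewrite /rook_graph /cartesian_product /complete_graph !eqxx. Qed.

(* Main.v *)
Require Import Defs.
From mathcomp Require Import all_boot all_order all_algebra all_field.
From mathcomp Require Import boolp reals.
From mathcomp Require Import zify ring lra.

Set Implicit Arguments.
Unset Strict Implicit.
Unset Printing Implicit Defensive.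

Import Order.TTheory GRing.Theory Num.Theory.

(** Non-adjacent vertices of the rook graph are opposite corners of a rectangle
    and have exactly two shortest paths, through the two other corners, so the
    mutual-visibility sets are the sets of cells containing no rectangle, i.e.
    the C4-free subgraphs of K_{n,n}. Double counting bounds the size of such a
    set by [2 n q] as soon as [n <= q ^ 2], so at least [n / (2 q)] colors are
    needed. Conversely, over a field [F] with [q] elements, send rows and columns
    injectively to points [(a, b)] and [(x, y)] of the plane [F ^ 2], and give a
    cell the color [y - a x - b]: a color class is a point-line incidence graph,
    hence C4-free. Both bounds are used with [q] the least power of 2 such that
    [n <= q ^ 2]. *)

Section RectangleFree.
Variables A B : finType.

Definition rectangle_free (S : {set A * B}) : Prop :=
  forall i i' j j', (i, j) \in S -> (i, j') \in S -> (i', j) \in S ->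
    (i', j') \in S -> i = i' \/ j = j'.

Lemma card_set_pair (S : {set A * B}) :
  #|S| = (\sum_i \sum_j ((i, j) \in S))%N.
Proof.
rewrite -sum1_card big_mkcond pair_bigA /=.
by apply: eq_bigr => -[i j] _; case: ifP.
Qed.

Lemma rectangle_free_codegree (S : {set A * B}) j j' :
  rectangle_free S -> j != j' ->
  (\sum_i ((i, j) \in S) * ((i, j') \in S) <= 1)%N.
Proof.
move=> rfS neq_jj'.
have -> : (\sum_i ((i, j) \in S) * ((i, j') \in S)
           = #|[set i | ((i, j) \in S) && ((i, j') \in S)]|)%N.
  rewrite -sum1_card [RHS]big_mkcond; apply: eq_bigr => i _.
  by rewrite inE mulnb; case: (_ && _).
apply/card_le1_eqP => i i'; rewrite !inE => /andP[ij ij'] /andP[i'j i'j'].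
case: (rfS i i' j j') => // eq_jj'.
by rewrite eq_jj' eqxx in neq_jj'.
Qed.

(** The squared row degrees count triples [(i, j, j')] with both cells in [S]. The diagonal [j = j']
    contributes [#|S|], and each pair [j != j'] at most 1. *)
Lemma rectangle_free_sum_degree_sqr (S : {set A * B}) :
  rectangle_free S ->
  (\sum_i (\sum_j ((i, j) \in S)) ^ 2 <= #|S| + #|B| ^ 2)%N.
Proof.
move=> rfS.
have -> : (\sum_i (\sum_j ((i, j) \in S)) ^ 2
    = \sum_j \sum_j' \sum_i ((i, j) \in S) * ((i, j') \in S))%N.
  under eq_bigr do rewrite -mulnn big_distrlr /=.
  by rewrite exchange_big; apply: eq_bigr => j _; rewrite exchange_big.
have -> : (#|S| + #|B| ^ 2
    = \sum_j \sum_j' ((j == j') * (\sum_i ((i, j) \in S)) + 1))%N.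
  rewrite card_set_pair exchange_big -mulnn -sum_nat_const -big_split /=.
  apply: eq_bigr => j _; rewrite big_split /= sum1_card; congr addn.
  rewrite (bigD1 j) //= eqxx mul1n [X in (_ + X)%N]big1 ?addn0 // => j' /negPf.
  by rewrite eq_sym => ->.
apply: leq_sum => j _; apply: leq_sum => j' _.
have [<-|neq_jj'] := eqVneq j j'; last exact: rectangle_free_codegree.
rewrite mul1n; apply: leq_trans (leq_addr _ _).
by apply: leq_sum => i _; case: (_ \in S).
Qed.

(** Sums [2 t d <= d ^ 2 + t ^ 2] over the row degrees [d]: a linearized Cauchy-Schwarz, with [t]
    left free. *)
Lemma rectangle_free_card (S : {set A * B}) t :
  rectangle_free S ->
  ((2 * t) * #|S| <= #|S| + #|B| ^ 2 + #|A| * t ^ 2)%N.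
Proof.
move=> rfS.
apply: leq_trans (leq_add (rectangle_free_sum_degree_sqr rfS) (leqnn _)).
rewrite -sum_nat_const -big_split card_set_pair big_distrr /=.
apply: leq_sum => i _.
by rewrite addnC -mulnA; apply: (nat_Cauchy t _).1.
Qed.

End RectangleFree.

Section RookGraph.
Variable n : nat.
Implicit Types (u v w : 'I_n * 'I_n) (S : {set 'I_n * 'I_n}).

Lemma rook_common_neighbor u v w :
  u.1 != v.1 -> u.2 != v.2 -> rook_graph u w -> rook_graph w v ->
  w = (u.1, v.2) \/ w = (v.1, u.2).
Proof.
case: u v w => [i j] [i' j'] [k l].
rewrite /rook_graph /cartesian_product /complete_graph /=.
move=> neq_i neq_j /orP[]/andP[/eqP eq1 _] /orP[]/andP[/eqP eq2 _]; subst;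
  rewrite ?eqxx // in neq_i neq_j *; by [left | right].
Qed.

Lemma mutual_visibility_rectangle_free S :
  mutual_visibility_set (@rook_graph n) S -> rectangle_free S.
Proof.
move=> mvS i i' j j' ij ij' i'j i'j'.
have [->|neq_i] := eqVneq i i'; first by left.
have [->|neq_j] := eqVneq j j'; first by right.
have [p [/and3P[pth /eqP lst _] short] visS] := mvS _ _ ij i'j'.
(* This two-step path limits [p] to length 2. Lengths 0 and 1 are impossible, so [p] passes through
   one of the other two corners, which lie in [S]. *)
have /short : is_path (@rook_graph n) (i, j) (i', j')
                      [:: (i, j'); (i', j')].
  rewrite /is_path /= /rook_graph /cartesian_product /complete_graph /=.
  by rewrite !inE !xpair_eqE !eqxx neq_i neq_j (negPf neq_i) (negPf neq_j) ?orbT.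
case: p pth lst visS {short} => [_ [/eqP]|w [|v [|//]]] /=.
- by rewrite (negPf neq_i).
- rewrite andbT => + eq_w; rewrite eq_w.
  rewrite /rook_graph /cartesian_product /complete_graph /=.
  by rewrite (negPf neq_i) (negPf neq_j).
move=> /and3P[uw wv _] eq_v visS _; rewrite {}eq_v in wv visS.
have wS : w \in S by case: (rook_common_neighbor _ _ uw wv) => // ->.
have : w \in [set (i, j); (i', j')] by rewrite -visS !inE eqxx orbT wS.
rewrite !inE => /orP[]/eqP eq_w; rewrite eq_w in uw wv.
- by rewrite rook_graph_irr in uw.
- by rewrite rook_graph_irr in wv.
Qed.

Lemma visible_adjacent S u v :
  u \in S -> v \in S -> rook_graph u v -> visible (@rook_graph n) S u v.
Proof.
move=> uS vS uv.
have neq_uv : u != v by apply: contraTneq uv => ->; rewrite rook_graph_irr.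
exists [:: v].
  split; first by rewrite /is_path /= uv eqxx inE neq_uv.
  by case=> // /and3P[_ /= eq_uv]; rewrite eq_uv in neq_uv.
apply/setP => w; rewrite !inE.
case: eqP => [->|_] /=; first by rewrite uS.
by case: eqP => [->|//]; rewrite vS.
Qed.

Lemma visible_corner S u v w :
  u \in S -> v \in S -> w \notin S -> u.1 != v.1 -> u.2 != v.2 ->
  rook_graph u w -> rook_graph w v -> visible (@rook_graph n) S u v.
Proof.
move=> uS vS wS neq1 neq2 uw wv.
have neq_uv : u != v by apply: contraNneq neq1 => ->.
have nadj_uv : ~~ rook_graph u v.
  by rewrite /rook_graph /cartesian_product (negPf neq1) (negPf neq2).
have neq_uw : u != w by apply: contraTneq uw => ->; rewrite rook_graph_irr.
have neq_wv : w != v by apply: contraTneq wv => ->; rewrite rook_graph_irr.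
exists [:: w; v].
  split; first by rewrite /is_path /= uw wv eqxx !inE neq_wv negb_or neq_uw neq_uv.
  case=> [|z [|//]] /and3P[]; first by move=> _ /= eq_uv; rewrite eq_uv in neq_uv.
  by rewrite /= andbT => uz /eqP eq_zv; rewrite eq_zv in uz; rewrite uz in nadj_uv.
apply/setP => z; rewrite !inE.
have [->|_] := eqVneq z u; first by rewrite uS.
have [->|_] /= := eqVneq z v; first by rewrite vS orbT.
by rewrite orbF; case: eqP => [->|//]; rewrite (negPf wS).
Qed.

(** For non-adjacent cells, one of the two remaining corners is missing from [S], and the shortest
    path through it is free. *)
Lemma rectangle_free_mutual_visibility S :
  rectangle_free S -> mutual_visibility_set (@rook_graph n) S.
Proof.
move=> rfS u v uS vS.
have [<-|neq_uv] := eqVneq u v; first exact: visible_refl.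
have [uv|] := boolP (rook_graph u v); first exact: visible_adjacent.
case: u v uS vS neq_uv => [i j] [i' j'] uS vS neq_uv nadj.
have [neq_i neq_j] : i != i' /\ j != j'.
  move: neq_uv nadj.
  rewrite /rook_graph /cartesian_product /complete_graph xpair_eqE /=.
  by case: eqP; case: eqP.
have [ij'|ij'] := boolP ((i, j') \in S); last first.
  apply: (visible_corner uS vS ij') => //;
  by rewrite /rook_graph /cartesian_product /complete_graph /= eqxx ?neq_i ?neq_j ?orbT.
have [i'j|i'j] := boolP ((i', j) \in S); last first.
  apply: (visible_corner uS vS i'j) => //;
  by rewrite /rook_graph /cartesian_product /complete_graph /= eqxx ?neq_i ?neq_j ?orbT.
by case: (rfS i i' j j') => // /eqP; rewrite ?(negPf neq_i) ?(negPf neq_j).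
Qed.

Lemma mv_coloring_lower_bound (P : {set {set 'I_n * 'I_n}}) q :
  (n <= q ^ 2)%N -> mv_coloring (@rook_graph n) P -> (n <= 2 * #|P| * q)%N.
Proof.
move=> le_nq [partP mvP].
have [n_le0|n_gt0] := leqP n 0; first exact: leq_trans n_le0 _.
have q_gt0 : (0 < q)%N by case: q le_nq => //; rewrite leqNgt n_gt0.
suff : (n * n <= #|P| * (2 * n * q))%N.
  by move=> le_nn; rewrite -(leq_pmul2l n_gt0) (leq_trans le_nn) //; nia.
have {1}-> : (n * n = #|[set: 'I_n * 'I_n]|)%N by rewrite cardsT card_prod card_ord.
rewrite (card_partition partP) -sum_nat_const; apply: leq_sum => S SP.
(* With [t = q], [(2 q - 1) #|S| <= n ^ 2 + n q ^ 2 <= 2 n q ^ 2]. Since [q <= 2 q - 1], this gives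
   [#|S| <= 2 n q]. *)
have := @rectangle_free_card _ _ S q (mutual_visibility_rectangle_free (mvP S SP)).
rewrite card_ord -(leq_pmul2l q_gt0) => le_S.
have : (n ^ 2 <= n * q ^ 2)%N by rewrite -mulnn leq_mul2l le_nq orbT.
have : (#|S| <= q * #|S|)%N by rewrite leq_pmull.
move: le_S; rewrite -!mulnn; move: #|S| => s.
nia.
Qed.

Lemma affine_color_class (F : finFieldType) (g : 'I_n -> F * F) (c : F) :
  injective g ->
  rectangle_free [set u : 'I_n * 'I_n |
    (c == (g u.2).2 - (g u.1).1 * (g u.2).1 - (g u.1).2)%R].
Proof.
move=> g_inj i i' j j'; rewrite !inE /=.
case Ei: (g i) => [a b]; case Ei': (g i') => [a' b'].
case Ej: (g j) => [x y]; case Ej': (g j') => [x' y'] /=.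
move=> /eqP e1 /eqP e2 /eqP e3 /eqP e4.
(* The alternating sum of the four corner equations cancels everything but this product. Equal
   slopes then force equal intercepts, and equal abscissas equal ordinates. *)
have : ((a - a') * (x - x') = 0)%R.
  apply: etrans (_ : _ = (c - (y - a * x - b)) - (c - (y' - a * x' - b))
    - (c - (y - a' * x - b')) + (c - (y' - a' * x' - b')))%R _; first by ring.
  by rewrite -e1 -e2 -e3 -e4 !subrr addr0.
move=> /eqP; rewrite mulf_eq0 !subr_eq0 => /orP[]/eqP eq_ax; subst.
  left; apply: g_inj; rewrite Ei Ei'; congr pair.
  by move: e3 => /addrI/oppr_inj.
right; apply: g_inj; rewrite Ej Ej'; congr pair.
by move: e2 => /addIr/addIr.
Qed.

Lemma mv_coloring_upper_bound (F : finFieldType) :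
  (n <= #|F| ^ 2)%N ->
  exists2 P, mv_coloring (@rook_graph n) P & (#|P| <= #|F|)%N.
Proof.
rewrite -mulnn -card_prod => le_nF.
pose g (i : 'I_n) : F * F := enum_val (widen_ord le_nF i).
have g_inj : injective g by move=> i i' /enum_val_inj [/val_inj].
pose f (u : 'I_n * 'I_n) := ((g u.2).2 - (g u.1).1 * (g u.2).1 - (g u.1).2)%R.
(* Only an inclusion: a color that is not attained has an empty fiber, which is not a class. It
   suffices for counting. *)
have sub_classes : preim_partition f [set: 'I_n * 'I_n]
    \subset [set [set u | c == f u] | c in F].
  apply/subsetP => _ /imsetP[u _ ->].
  by apply/imsetP; exists (f u) => //; apply/setP => v; rewrite !inE.
exists (preim_partition f [set: _]).
  split; first exact: preim_partitionP.
  move=> S /(subsetP sub_classes)/imsetP[c _ ->].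
  exact/rectangle_free_mutual_visibility/affine_color_class.
exact: leq_trans (subset_leq_card sub_classes) (leq_imset_card _ _).
Qed.

End RookGraph.

Local Open Scope ring_scope.

Theorem theorem3p2 (R : realType) :
  exists c1 c2 : R, exists N : nat,
    [/\ 0 < c1, 0 < c2 &
      forall n : nat, (N <= n)%N ->
        c1 * Num.sqrt (n%:R : R)
          <= (mv_chromatic_number (@rook_graph n))%:R
          <= c2 * Num.sqrt (n%:R : R)].
Proof.
(* Minimality of [q] gives [q <= 2 s] with [s] the root of [n]. So [q] colors yield the constant 2,
   and [n <= 2 k q <= 4 k s] yields 1/4. From [2 <= n] comes [0 < m], hence a field of order
   [2 ^ m]. *)
exists (4^-1), 2, 2%N; split; [lra | lra | move=> n n_ge2].
pose m := up_log 4 n; pose q := (2 ^ m)%N.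
have q2E : (q ^ 2 = 4 ^ m)%N by rewrite -expnM mulnC expnM.
have le_nq : (n <= q ^ 2)%N by rewrite q2E up_logP.
have m_gt0 : (0 < m)%N by rewrite up_log_gt0.
(* By minimality of [m], [4 ^ (m - 1) < n]. *)
have lt_q : (q ^ 2 <= 4 * n)%N.
  rewrite q2E -(prednK m_gt0) expnS leq_mul2l /= ltnW //.
  exact: up_log_gtn.
have [F _ cardF] := pPrimePowerField (isT : prime 2) m_gt0.
rewrite -/q in cardF.
set s := Num.sqrt (n%:R : R).
have s2E : s ^+ 2 = n%:R by rewrite sqr_sqrtr.
have s_gt0 : 0 < s by rewrite sqrtr_gt0 ltr0n; lia.
have le_qs : (q%:R : R) <= 2 * s.
  rewrite -(@ler_pXn2r _ 2) ?nnegrE ?ler0n ?mulr_ge0 ?(ltW s_gt0) //.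
  by rewrite exprMn s2E -natrX -(natrX _ 2 2) -natrM ler_nat.
rewrite /mv_chromatic_number; case: ex_minnP => k /asboolP[P colP <-] min_k.
apply/andP; split.
  have := mv_coloring_lower_bound le_nq colP.
  rewrite -(ler_nat R) !natrM -s2E => le_s.
  have : s ^+ 2 <= 4 * #|P|%:R * s.
    apply: le_trans le_s _.
    have : 0 <= (#|P|%:R : R) by [].
    nra.
  by rewrite expr2 ler_pM2r //; lra.
have [|Q colQ le_Q] := @mv_coloring_upper_bound n F; first by rewrite cardF.
apply: le_trans le_qs; rewrite ler_nat -cardF; apply: leq_trans le_Q.
by apply: min_k; apply/asboolP; exists Q.
Qed.
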